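(* Let $(u,\boldsymbol q)$ and $(\xi,\boldsymbol\zeta)$ be the exact solutions of the primal and adjoint problems and let $s=\ell^O(u,\boldsymbol q)$ be the quantity of interest (see context). For any $(\tilde u_h,\tilde{\boldsymbol q}_h)$ and $(\tilde\xi_h,\tilde{\boldsymbol\zeta}_h)$ in $H^1(\Omega)\times H(\mathrm{div};\Omega)$ and any $\kappa\in(0,+\infty)$, the following holds for each of the two consistent choices of signs (all upper signs, or all lower signs): $$\begin{aligned}\pm s={}&\pm\hat s_h^\mp+\frac1{4\kappa}\,|||\boldsymbol e_{\boldsymbol\varphi}^\mp-\nu\nabla e_\phi^\mp|||^2+\big(u,\ \pm(f^O-\nabla\cdot\tilde{\boldsymbol\zeta}_h)-\kappa(f-\nabla\cdot\tilde{\boldsymbol q}_h)\big)\\&-\big\langle u,\ \mp(g_N^O+\tilde{\boldsymbol\zeta}_h\cdot\boldsymbol n)-\kappa(g_N-\tilde{\boldsymbol q}_h\cdot\boldsymbol n)\big\rangle_{\Gamma_N}-\big\langle\boldsymbol q\cdot\boldsymbol n,\ \mp(g_D^O-\tilde\xi_h)-\kappa(g_D-\tilde u_h)\big\rangle_{\Gamma_D},\end{aligned}$$ where $$\pm\hat s_h^\mp=\pm\ell(\tilde\xi_h,-\tilde{\boldsymbol\zeta}_h)+\kappa\,\ell(\tilde u_h,\tilde{\boldsymbol q}_h)-\frac1{4\kappa}\,|||\pm(\tilde{\boldsymbol\zeta}_h+\nu\nabla\tilde\xi_h)-\kappa(\tilde{\boldsymbol q}_h-\nu\nabla\tilde u_h)|||^2,$$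 $$e_\phi^\mp=\mp(\xi-\tilde\xi_h)-\kappa(u-\tilde u_h),\qquad \boldsymbol e_{\boldsymbol\varphi}^\mp=\pm(\boldsymbol\zeta-\tilde{\boldsymbol\zeta}_h)-\kappa(\boldsymbol q-\tilde{\boldsymbol q}_h).$$
   Context: Setting. $\Omega\subset\mathbb R^d$, $d\in\{2,3\}$, is a polygonal/polyhedral domain with outward unit normal $\boldsymbol n$; $\partial\Omega=\overline{\Gamma}_D\cup\overline{\Gamma}_N$ with $\Gamma_D\cap\Gamma_N=\emptyset$ and $\Gamma_D$ non-empty (relatively open). The coefficient $\nu\in L^\infty(\Omega)$ is strictly positive and piecewise constant on (finitely many) subdomains of $\Omega$. Data: $f,f^O\in L^2(\Omega)$, $g_N,g_N^O\in L^2(\Gamma_N)$, $g_D,g_D^O\in C(\Gamma_D)$, regular enough that the problems below have solutions. Notation. $(\cdot,\cdot)$ is the $L^2(\Omega)$ inner product (scalar or vector valued). $\langle\cdot,\cdot\rangle_{\gamma}$ is the integral of the product over $\gamma\subset\partial\Omega$; when one factor is the normal trace of an $H(\mathrm{div};\Omega)$ field it is read as the corresponding duality pairing (all boundary terms that appear being understood to be well defined and bilinear, e.g. because the normal traces are in $L^2(\partial\Omega)$), and the Green formula $(\boldsymbol v,\nabla w)+(\nabla\cdot\boldsymbol v,w)=\langle\boldsymbol v\cdot\boldsymbol n,w\rangle_{\Gamma_D}+\langle\boldsymbol v\cdot\boldsymbol n,w\rangle_{\Gamma_N}$ holds for $\boldsymbol v\in H(\mathrm{div};\Omega)$, $w\in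 H^1(\Omega)$. Here $H(\mathrm{div};\Omega)=\{\boldsymbol v\in[L^2(\Omega)]^d:\nabla\cdot\boldsymbol v\in L^2(\Omega)\}$. The energy norm is $|||\boldsymbol v|||=(\nu^{-1}\boldsymbol v,\boldsymbol v)^{1/2}$. Primal problem: $(u,\boldsymbol q)\in H^1(\Omega)\times H(\mathrm{div};\Omega)$ is the (weak) solution of $\boldsymbol q=-\nu\nabla u$ in $\Omega$, $\nabla\cdot\boldsymbol q=f$ in $\Omega$, $u=g_D$ on $\Gamma_D$, $\boldsymbol q\cdot\boldsymbol n=g_N$ on $\Gamma_N$. Adjoint problem: $(\xi,\boldsymbol\zeta)\in H^1(\Omega)\times H(\mathrm{div};\Omega)$ is the (weak) solution of $\boldsymbol\zeta=-\nu\nabla\xi$ in $\Omega$, $\nabla\cdot\boldsymbol\zeta=f^O$ in $\Omega$, $\xi=g_D^O$ on $\Gamma_D$, $\boldsymbol\zeta\cdot\boldsymbol n=-g_N^O$ on $\Gamma_N$. Functionals on $H^1(\Omega)\times H(\mathrm{div};\Omega)$: $\ell(w,\boldsymbol v)=(f,w)-\langle g_D,\boldsymbol v\cdot\boldsymbol n\rangle_{\Gamma_D}-\langle g_N,w\rangle_{\Gamma_N}$ and $\ell^O(w,\boldsymbol v)=(f^O,w)+\langle g_D^O,\boldsymbol v\cdot\boldsymbol n\rangle_{\Gamma_D}+\langle g_N^O,w\rangle_{\Gamma_N}$. The quantity of interest is $s=\ell^O(u,\boldsymbol q)$. *)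

(* Defs.v *)
From HB Require Import structures.
From mathcomp Require Import all_boot all_order all_algebra.
From mathcomp Require Import all_classical all_reals all_analysis.

Set Implicit Arguments.
Unset Strict Implicit.
Unset Printing Implicit Defensive.

Import Order.TTheory GRing.Theory Num.Theory.
Import numFieldNormedType.Exports.

Local Open Scope classical_set_scope.
Local Open Scope ring_scope.

(* The outer measure generated by a weighted family of sets [B i], [i : I].
   [None] stands for the empty set, of weight 0, so that the countable covers
   [F : nat -> option I] include the finite ones. *)
Definition cover_outer_measure (R : realType) (T I : Type) (B : I -> set T)
    (tau : I -> \bar R) (A : set T) : \bar R :=
  ereal_inf [set (\sum_(k <oo) oapp tau 0 (F k))%E | F in
    [set F : nat -> option I | A `<=` \bigcup_k oapp B set0 (F k)]].

Section cover_outer_measure_theory.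
Context (R : realType) (T I : Type) (B : I -> set T) (tau : I -> \bar R).
Hypothesis tau_ge0 : forall i, (0 <= tau i)%E.
Local Open Scope ereal_scope.
Local Notation mu := (cover_outer_measure B tau).

Lemma oapp_tau_ge0 o : 0 <= oapp tau 0 o.
Proof. by case: o. Qed.
Hint Resolve oapp_tau_ge0 : core.

Lemma cover_outer_measure_ge0 A : 0 <= mu A.
Proof.
apply: le_ereal_inf_tmp => x [F _ <-].
by apply: nneseries_ge0 => n _ _.
Qed.

Lemma cover_outer_measure0 : mu set0 = 0.
Proof.
apply/eqP; rewrite eq_le cover_outer_measure_ge0 andbT.
apply: ereal_inf_lbound; exists (fun=> None); first by move=> x.
by rewrite eseries0.
Qed.

Lemma le_cover_outer_measure : {homo mu : A C / A `<=` C >-> A <= C}.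
Proof.
move=> A C AC; apply: ereal_inf_le_tmp => x [F FC <-].
by exists F => //; exact: subset_trans FC.
Qed.

Lemma cover_outer_measure_sigma_subadditive : sigma_subadditive mu.
Proof.
move=> A; have [[i ioo]|] := pselect (exists i, mu (A i) = +oo).
  rewrite (eseries_pinfty _ _ ioo) ?leey// => n _.
  by rewrite -ltNye (lt_le_trans _ (cover_outer_measure_ge0 _)).
rewrite -forallNE => Aoo.
suff add2e (e : {posnum R}) :
    mu (\bigcup_n A n) <= \sum_(i <oo) mu (A i) + e%:num%:E.
  by apply/lee_addgt0Pr => _/posnumP[].
rewrite (le_trans _ (epsilon_trick _ _ _))//; last first.
  by move=> n; exact: cover_outer_measure_ge0.
pose P n (F : nat -> option I) := A n `<=` \bigcup_k oapp B set0 (F k) /\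
  \sum_(k <oo) oapp tau 0 (F k) <= mu (A n) + (e%:num / (2 ^ n.+1)%:R)%:E.
have [G PG] : {G : nat -> nat -> option I & forall n, P n (G n)}.
  apply: (@choice _ _ P) => n; rewrite /P /cover_outer_measure.
  set S := (X in ereal_inf X); move infS : (ereal_inf S) => iS.
  case: iS infS => [r Sr|Soo|Soo].
  - have en1 : (0 < e%:num / (2 ^ n.+1)%:R)%R by [].
    have /(lb_ereal_inf_adherent en1) : ereal_inf S \is a fin_num by rewrite Sr.
    move=> [x [F AnF muFx] xS].
    by exists F; split => //; rewrite muFx -Sr; exact/ltW.
  - by have := Aoo n; rewrite /cover_outer_measure Soo.
  - have : lbound S 0 by move=> _ [F AnF <-]; exact: nneseries_ge0.
    by move/le_ereal_inf_tmp; rewrite Soo.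
pose g (ij : nat * nat) := oapp tau 0 (G ij.1 ij.2).
have g_ge0 x : 0 <= g x by exact: oapp_tau_ge0.
apply: (@le_trans _ _ (\esum_(i in setT) g i)).
  apply: ereal_inf_lbound => /=.
  have /card_esym/ppcard_eqP[f] := card_nat2.
  exists (fun k => G (f k).1 (f k).2).
    move=> t [i _ /(PG i).1 [j _ Gij]].
    by exists (f^-1%FUN (i, j)) => //=; rewrite invK ?inE.
  rewrite -(esum_pred_image g _ xpredT) ?[fun=> _]set_true//.
  by rewrite image_eq.
rewrite (_ : esum _ _ = \sum_(i <oo) \sum_(j <oo) oapp tau 0 (G i j)); last first.
  pose J : nat -> set (nat * nat) := fun i => [set (i, j) | j in setT].
  rewrite (_ : setT = \bigcup_k J k); last first.
    by rewrite predeqE => -[a b]; split => // _; exists a => //; exists b.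
  rewrite esum_bigcupT /=; last 2 first.
  - apply/trivIsetP => i j _ _ ij.
    rewrite predeqE => -[n m] /=; split => //= -[] [_] _ [<-{n} _].
    by move=> [m' _] [] /esym/eqP; rewrite (negbTE ij).
  - by [].
  rewrite -(image_id [set: nat]) -fun_true esum_pred_image//; last first.
    by move=> n _; exact: esum_ge0.
  apply: eq_eseriesr => /= j _.
  rewrite -(esum_pred_image g (pair j) predT)//=; last first.
    by move=> ? ? _ _; exact: (@can_inj _ _ _ snd).
  by congr esum; rewrite predeqE => -[a b]; split; move=> [i _ <-]; exists i.
apply: lee_lim.
- by apply: is_cvg_nneseries => n *; exact: nneseries_ge0.
- apply: is_cvg_nneseries => n *.
  by apply: adde_ge0 => //; exact: cover_outer_measure_ge0.
- by near=> n; apply: lee_sum => i _; exact: (PG i).2.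
Unshelve. all: by end_near. Qed.

End cover_outer_measure_theory.

Section euclidean_space.
Context (R : realType) (d : nat).
Local Notation E := 'rV[R]_d.

Definition dot (x y : E) : R := \sum_(i < d) x 0 i * y 0 i.

(* The library's norm on ['rV_d] is the sup norm. *)
Definition eucl_norm (x : E) : R := Num.sqrt (dot x x).

Definition box (ab : E * E) : set E :=
  [set x | forall i, ab.1 0 i <= x 0 i < ab.2 0 i].

Definition box_volume (ab : E * E) : \bar R :=
  (\prod_(i < d) Num.max 0 (ab.2 0 i - ab.1 0 i))%:E.

(* Lebesgue outer measure; its restriction to the Caratheodory measurable
   (i.e. Lebesgue measurable) sets is Lebesgue measure. *)
Definition lebesgue_outer : set E -> \bar R :=
  cover_outer_measure box box_volume.

Lemma box_volume_ge0 ab : (0 <= box_volume ab)%E.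
Proof. by rewrite lee_fin prodr_ge0// => i _; rewrite le_max lexx. Qed.

HB.instance Definition _ := isOuterMeasure.Build R E lebesgue_outer
  (cover_outer_measure0 box box_volume_ge0)
  (cover_outer_measure_ge0 box box_volume_ge0)
  (@le_cover_outer_measure _ _ _ box box_volume)
  (cover_outer_measure_sigma_subadditive box box_volume_ge0).

Definition diam (U : set E) : \bar R :=
  maxe 0%E (ereal_sup [set (eucl_norm (z.1 - z.2))%:E | z in U `*` U]).

(* Volume of the unit ball of R^m: 1, 2, pi, 4 pi / 3, ... *)
Fixpoint unit_ball_volume (m : nat) : R :=
  match m with
  | 0 => 1
  | 1 => 2
  | m'.+2 => 2 * pi / m'.+2%:R * unit_ball_volume m'
  end.

Definition hausdorff_weight (m : nat) (U : set E) : \bar R :=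
  ((unit_ball_volume m / 2 ^+ m)%:E * diam U ^+ m)%E.

Definition hausdorff_delta (m : nat) (delta : R) : set E -> \bar R :=
  cover_outer_measure
    (fun U : {U : set E | (diam U <= delta%:E)%E} => sval U)
    (fun U => hausdorff_weight m (sval U)).

(* m-dimensional Hausdorff outer measure, normalized so that it is the
   m-dimensional surface area on m-dimensional affine subspaces. *)
Definition hausdorff_outer (m : nat) (A : set E) : \bar R :=
  ereal_sup [set hausdorff_delta m delta A | delta in [set delta | 0 < delta]].

Lemma unit_ball_volume_ge0 m : 0 <= unit_ball_volume m.
Proof.
suff : 0 <= unit_ball_volume m /\ 0 <= unit_ball_volume m.+1 by case.
elim: m => [|m [h0 h1]]; first by split; rewrite ?ler01 ?ler0n.
split => //; rewrite -/unit_ball_volume/= mulr_ge0//.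
by rewrite divr_ge0 ?ler0n// mulr_ge0 ?ler0n// pi_ge0.
Qed.

Lemma hausdorff_weight_ge0 m U : (0 <= hausdorff_weight m U)%E.
Proof.
rewrite mule_ge0//.
  by rewrite lee_fin divr_ge0 ?exprn_ge0// unit_ball_volume_ge0.
by rewrite expe_ge0// le_max lexx.
Qed.

Section hausdorff_instance.
Variable m : nat.
Local Open Scope ereal_scope.

Let weight_ge0 (delta : R) (U : {U : set E | diam U <= delta%:E}) :
  0 <= hausdorff_weight m (sval U) := hausdorff_weight_ge0 m (sval U).

Lemma hausdorff_outer_ge0 A : 0 <= hausdorff_outer m A.
Proof.
apply: le_ereal_sup_tmp; exists (hausdorff_delta m 1 A) => /=.
  by exists 1%R => //=; exact: ltr01.
exact/cover_outer_measure_ge0/weight_ge0.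
Qed.

Lemma hausdorff_outer0 : hausdorff_outer m set0 = 0.
Proof.
apply/eqP; rewrite eq_le hausdorff_outer_ge0 andbT.
apply: ge_ereal_sup => _ [delta _ <-].
by rewrite /hausdorff_delta cover_outer_measure0.
Qed.

Lemma le_hausdorff_outer :
  {homo hausdorff_outer m : A C / A `<=` C >-> A <= C}.
Proof.
move=> A C AC; apply: ge_ereal_sup => _ [delta delta0 <-].
apply: le_ereal_sup_tmp; exists (hausdorff_delta m delta C); first by exists delta.
exact: le_cover_outer_measure.
Qed.

Lemma hausdorff_outer_sigma_subadditive :
  sigma_subadditive (hausdorff_outer m).
Proof.
move=> F; apply: ge_ereal_sup => _ [delta delta0 <-].
apply: le_trans (cover_outer_measure_sigma_subadditive _ (@weight_ge0 delta) F) _.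
apply: lee_nneseries => [k _ _|k _].
  exact/cover_outer_measure_ge0/weight_ge0.
by apply: ereal_sup_ubound => /=; exists delta.
Qed.

HB.instance Definition _ := isOuterMeasure.Build R E (hausdorff_outer m)
  hausdorff_outer0 hausdorff_outer_ge0 le_hausdorff_outer
  hausdorff_outer_sigma_subadditive.

End hausdorff_instance.

End euclidean_space.

Arguments lebesgue_outer {R d}.
Arguments hausdorff_outer {R d} m.

Section measures.
Context (R : realType) (d : nat).

Let leb : {outer_measure set 'rV[R]_d -> \bar R} := lebesgue_outer.

Definition lebesgue_measure_rV :
    {measure set (caratheodory_type leb) -> \bar R} :=
  (leb : set (caratheodory_type leb) -> \bar R).

Let haus : {outer_measure set 'rV[R]_d -> \bar R} := hausdorff_outer d.-1.

(* Surface measure on (d-1)-dimensional subsets of R^d. *)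
Definition surface_measure :
    {measure set (caratheodory_type haus) -> \bar R} :=
  (haus : set (caratheodory_type haus) -> \bar R).

End measures.

Notation vol := (lebesgue_measure_rV _ _).
Notation surf := (surface_measure _ _).

Section integration.
Context (dsp : measure_display) (T : measurableType dsp) (R : realType).
Context (mu : {measure set T -> \bar R}) (D : set T).

(* [measurable_fun D f] is void when [D] is not measurable. *)
Definition L2 (f : T -> R) : Prop :=
  [/\ measurable D, measurable_fun D f &
      mu.-integrable D (fun x => (f x ^+ 2)%:E)].

Definition ip (f g : T -> R) : R := \int[mu]_(x in D) (f x * g x).

Definition L2dist2 (f g : T -> R) : \bar R :=
  (\int[mu]_(x in D) ((f x - g x) ^+ 2)%:E)%E.

End integration.

Section calculus.
Context (R : realType) (d : nat).
Local Notation E := 'rV[R]_d.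

Definition partial (i : 'I_d) (f : E -> R) : E -> R :=
  fun x => 'D_(delta_mx 0 i) f x.

Fixpoint Ck (k : nat) (f : E -> R) : Prop :=
  continuous f /\
  match k with
  | 0 => True
  | k'.+1 => forall i,
      (forall x, derivable f x (delta_mx 0 i)) /\ Ck k' (partial i f)
  end.

Definition smooth (f : E -> R) : Prop := forall k, Ck k f.

Definition gradient (f : E -> R) : E -> E := fun x => \row_i partial i f x.

Definition divergence (v : E -> E) : E -> R :=
  fun x => \sum_(i < d) partial i (fun y => v y 0 i) x.

Definition smooth_field (v : E -> E) : Prop :=
  forall i, smooth (fun x => v x 0 i).

Definition test_function (Om : set E) (phi : E -> R) : Prop :=
  smooth phi /\
  exists K, [/\ compact K, K `<=` Om & forall x, ~ K x -> phi x = 0].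

Definition L2field (Om : set E) (v : E -> E) : Prop :=
  forall i, L2 vol Om (fun x => v x 0 i).

Definition ipfield (Om : set E) (v w : E -> E) : R :=
  \int[vol]_(x in Om) dot (v x) (w x).

Definition L2dist2_field (Om : set E) (v w : E -> E) : \bar R :=
  (\int[vol]_(x in Om) (dot (v x - w x) (v x - w x))%:E)%E.

End calculus.

Section domain.
Context (R : realType) (d : nat).
Local Notation E := 'rV[R]_d.

Definition convex_hull (s : seq E) : set E :=
  [set x | exists a : 'I_(size s) -> R,
    [/\ forall i, 0 <= a i, \sum_i a i = 1 & x = \sum_i a i *: s`_i]].

Definition boundary (A : set E) : set E := closure A `\` A°.

(* A nonempty connected open set that equals the interior of its closure (no
   slits) and whose closure is a finite union of convex polytopes; it is in
   particular bounded. *)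
Definition polyhedral_domain (Om : set E) : Prop :=
  [/\ open Om, connected Om, Om !=set0, (closure Om)° = Om &
      exists (n : nat) (V : 'I_n -> seq E),
        closure Om = \bigcup_(k in [set: 'I_n]) convex_hull (V k)].

(* Near [x], [Om] is the half-space with outward unit normal [n]; on a
   polyhedral domain this has a (unique) solution [n] at almost every boundary
   point, namely at the points interior to a facet. *)
Definition is_outward_normal (Om : set E) (x n : E) : Prop :=
  dot n n = 1 /\ \forall y \near x, Om y <-> dot (y - x) n < 0.

Definition outward_normal (Om : set E) (x : E) : E :=
  xget 0 [set n | is_outward_normal Om x n].

Definition boundary_partition (Om GD GN : set E) : Prop :=
  [/\ boundary Om = closure GD `|` closure GN, GD `&` GN = set0, GD !=set0 &
      exists2 U, open U & GD = U `&` boundary Om].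

(* Strictly positive and constant on each of finitely many disjoint subdomains
   that cover [Om] up to a Lebesgue-null set; the values on that null set are
   irrelevant. *)
Definition piecewise_constant_coefficient (Om : set E) (nu : E -> R) : Prop :=
  exists (n : nat) (A : 'I_n -> set E) (c : 'I_n -> R),
    [/\ forall k, [/\ open (A k), connected (A k), A k !=set0 & A k `<=` Om],
        trivIset setT A,
        vol (Om `\` \bigcup_(k in [set: 'I_n]) A k) = 0%E,
        forall k, 0 < c k &
        forall k x, A k x -> nu x = c k].

End domain.

(* An element of H^1 is a pair (w, grad w) and an element of H(div) is a pair
   (v, div v), where grad and div are weak derivatives; since these are unique
   up to Lebesgue-null sets, this is the usual space, presented as the graph of
   the weak differential operator.  The vector space operations on pairs are
   those of H^1 and H(div). *)
Notation sobolev R d :=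
  (('rV[R]_d -> R) * ('rV[R]_d -> 'rV[R]_d))%type (only parsing).
Notation hdiv R d :=
  (('rV[R]_d -> 'rV[R]_d) * ('rV[R]_d -> R))%type (only parsing).

Section spaces.
Context (R : realType) (d : nat) (Om : set 'rV[R]_d).
Local Notation E := 'rV[R]_d.

Definition grad (w : sobolev R d) : E -> E := w.2.
Definition div (v : hdiv R d) : E -> R := v.2.

Definition H1 : set (sobolev R d) :=
  [set w | [/\ L2 vol Om w.1, L2field Om (grad w) &
    forall phi i, test_function Om phi ->
      ip vol Om w.1 (partial i phi) = - ip vol Om (fun x => grad w x 0 i) phi]].

Definition Hdiv : set (hdiv R d) :=
  [set v | [/\ L2field Om v.1, L2 vol Om (div v) &
    forall phi, test_function Om phi ->
      ipfield Om v.1 (gradient phi) = - ip vol Om (div v) phi]].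

(* Boundary values are L^2(boundary) limits of the boundary values of smooth
   functions (fields) that converge in H^1 (in H(div)). *)
Definition is_trace (w : sobolev R d) (g : E -> R) : Prop :=
  L2 surf (boundary Om) g /\
  exists phi : nat -> E -> R,
    [/\ forall k, smooth (phi k),
        L2dist2 vol Om (phi k) w.1 @[k --> \oo] --> 0%E,
        L2dist2_field Om (gradient (phi k)) (grad w) @[k --> \oo] --> 0%E &
        L2dist2 surf (boundary Om) (phi k) g @[k --> \oo] --> 0%E].

Definition trace (w : sobolev R d) : E -> R :=
  xget (cst 0) [set g | is_trace w g].

Definition is_normal_trace (v : hdiv R d) (h : E -> R) : Prop :=
  L2 surf (boundary Om) h /\
  exists phi : nat -> E -> E,
    [/\ forall k, smooth_field (phi k),
        L2dist2_field Om (phi k) v.1 @[k --> \oo] --> 0%E,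
        L2dist2 vol Om (divergence (phi k)) (div v) @[k --> \oo] --> 0%E &
        L2dist2 surf (boundary Om)
          (fun x => dot (phi k x) (outward_normal Om x)) h
          @[k --> \oo] --> 0%E].

(* Functions on the part [G] of the boundary that are traces on [G] of H^1
   functions. *)
Definition trace_space (G : set E) : set (E -> R) :=
  [set g | exists2 w, H1 w &
    {ae surf, forall x, G x -> g x = trace w x}].

End spaces.

Definition linear_on (R : realType) (V : lmodType R) (A : set V) (f : V -> R) :
    Prop :=
  forall (n : nat) (a : 'I_n -> R) (x : 'I_n -> V), (forall k, A (x k)) ->
    f (\sum_(k < n) a k *: x k) = \sum_(k < n) a k * f (x k).

Section boundary_pairings.
Context (R : realType) (d : nat) (Om : set 'rV[R]_d).
Local Notation E := 'rV[R]_d.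

(* [b v g] stands for <v.n, g>_G, so that [b v] is the normal trace of [v] on
   [G] as a functional.  A normal trace in L^2(boundary) acts by integration;
   for a general [v] in H(div), only bilinearity on traces is assumed. *)
Record normal_pairing (G : set E) (b : hdiv R d -> (E -> R) -> R) : Prop := {
  normal_pairing_linearl : forall g, trace_space Om G g ->
    linear_on (Hdiv Om) (b ^~ g);
  normal_pairing_linearr : forall v, Hdiv Om v ->
    linear_on (trace_space Om G) (b v);
  normal_pairing_ae : forall v g g', Hdiv Om v ->
    trace_space Om G g -> trace_space Om G g' ->
    {ae surf, forall x, G x -> g x = g' x} -> b v g = b v g';
  normal_pairing_L2 : forall v h g, Hdiv Om v -> is_normal_trace Om v h ->
    trace_space Om G g -> b v g = ip surf G h g }.

Definition green_formula (bD bN : hdiv R d -> (E -> R) -> R) : Prop :=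
  forall v w, Hdiv Om v -> H1 Om w ->
    ipfield Om v.1 (grad w) + ip vol Om (div v) w.1 =
    bD v (trace Om w) + bN v (trace Om w).

End boundary_pairings.

Section problem.
Context (R : realType) (d : nat) (Om GD GN : set 'rV[R]_d).
Local Notation E := 'rV[R]_d.
Context (bD bN : hdiv R d -> (E -> R) -> R).
Context (nu : E -> R).

(* A function in L^2(G) as a functional on boundary functions. *)
Definition L2_functional (G : set E) (g : E -> R) : (E -> R) -> R :=
  fun h => ip surf G g h.

Definition weighted (a : E -> R) (v : E -> E) : E -> E := fun x => a x *: v x.

Definition energy_norm (v : E -> E) : R :=
  Num.sqrt (ipfield Om (weighted (fun x => (nu x)^-1) v) v).

(* Weak solution of  q = - nu grad u,  div q = f  in Om,  u = gD  on GD,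
   q.n = gN  on GN. *)
Definition mixed_solution (f gD gN : E -> R) (u : sobolev R d) (q : hdiv R d) :
    Prop :=
  [/\ H1 Om u /\ Hdiv Om q,
      {ae vol, forall x, Om x -> q.1 x = - weighted nu (grad u) x},
      {ae vol, forall x, Om x -> div q x = f x},
      {ae surf, forall x, GD x -> trace Om u x = gD x} &
      {in trace_space Om GN, bN q =1 L2_functional GN gN}].

Definition ell (f gD gN : E -> R) (w : sobolev R d) (v : hdiv R d) : R :=
  ip vol Om f w.1 - bD v gD - ip surf GN gN (trace Om w).

Definition ellO (fO gDO gNO : E -> R) (w : sobolev R d) (v : hdiv R d) : R :=
  ip vol Om fO w.1 + bD v gDO + ip surf GN gNO (trace Om w).

(* The sign [sg] is 1 for the upper and -1 for the lower signs; the outer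
   factor [sg] solves  (+/-) s_hat = ...  for s_hat. *)
Definition s_hat (sg kappa : R) (f gD gN : E -> R)
    (ut xit : sobolev R d) (qt zetat : hdiv R d) : R :=
  sg * (sg * ell f gD gN xit (- zetat) + kappa * ell f gD gN ut qt
        - (4 * kappa)^-1 *
          energy_norm (sg *: (zetat.1 + weighted nu (grad xit))
                       - kappa *: (qt.1 - weighted nu (grad ut))) ^+ 2).

Definition e_phi (sg kappa : R) (u ut xi xit : sobolev R d) : sobolev R d :=
  (- sg) *: (xi - xit) - kappa *: (u - ut).

Definition e_varphi (sg kappa : R) (q qt zeta zetat : hdiv R d) : hdiv R d :=
  sg *: (zeta - zetat) - kappa *: (q - qt).

End problem.

(* Main.v *)
(* Write X for the field in the energy norm of the error and Y for the one in
   s_hat.  The constitutive laws q = - nu grad u and zeta = - nu grad xi give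
   X = - 2 kappa q - Y, hence
     (|||X|||^2 - |||Y|||^2) / (4 kappa) = kappa (nu^-1 q, q) + (nu^-1 q, Y),
   and nu^-1 q = - grad u turns the right-hand side into pairings of a flux with
   a gradient, which the Green formula evaluates.  The rest is linear algebra.

   Expanding the norms requires nu to be Lebesgue measurable on the domain.  Up
   to a null set nu is a combination of indicators of open sets, and open sets
   are Caratheodory measurable because a half-space cuts a box into two boxes
   whose volumes add up to that of the box. *)
Require Import Defs.
From mathcomp Require Import all_boot all_order all_algebra.
From mathcomp Require Import all_classical all_reals all_analysis.
From mathcomp Require Import measurable_realfun.
From mathcomp Require Import ring lra.

Import Order.TTheory GRing.Theory Num.Theory.
Import numFieldNormedType.Exports.

Local Open Scope classical_set_scope.
Local Open Scope ring_scope.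

(** * Square-integrable functions and changes on null sets *)

Section square_integrable.
Context {dsp : measure_display} {T : measurableType dsp} {R : realType}.
Context {mu : {measure set T -> \bar R}} {D : set T}.

(** Since [(|f| - |g|)^2 >= 0], the product is dominated by [f^2 + g^2]. *)
Lemma L2M_integrable (f g : T -> R) : L2 mu D f -> L2 mu D g ->
  mu.-integrable D (EFin \o (fun x => f x * g x)).
Proof.
move=> [mD mf f2] [_ mg g2].
apply: (le_integrable mD _ _ (integrableD mD f2 g2)).
  by apply/measurable_EFinP; exact: measurable_funM.
move=> x _ /=; rewrite lee_fin normrM.
rewrite (ger0_norm (addr_ge0 (sqr_ge0 _) (sqr_ge0 _))).
rewrite -(real_normK (num_real (f x))) -(real_normK (num_real (g x))).
move: `|f x| `|g x| (normr_ge0 (f x)) (normr_ge0 (g x)) => a b a0 b0.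
have := sqr_ge0 (a - b); nra.
Qed.

Lemma le_L2 (f g : T -> R) : measurable_fun D f ->
  (forall x, D x -> `|f x| <= `|g x|) -> L2 mu D g -> L2 mu D f.
Proof.
move=> mf fg [mD mg g2]; split=> //; apply: (le_integrable mD _ _ g2).
  by apply/measurable_EFinP; exact: measurable_funX.
move=> x Dx /=; rewrite lee_fin !normrX lerXn2r ?nnegrE//; exact: fg.
Qed.

Lemma L2Z (a : R) (f : T -> R) : L2 mu D f -> L2 mu D (fun x => a * f x).
Proof.
move=> [mD mf f2]; split=> //.
  by apply: measurable_funM => //; exact: measurable_cst.
apply: (eq_integrable mD _ _ _ (integrableZl mD (a ^+ 2) f2)) => x _ /=.
by rewrite -EFinM exprMn.
Qed.

Lemma L2D (f g : T -> R) : L2 mu D f -> L2 mu D g ->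
  L2 mu D (fun x => f x + g x).
Proof.
move=> Lf Lg; have [mD mf f2] := Lf; have [_ mg g2] := Lg; split=> //.
  exact: measurable_funD.
have fg := L2M_integrable _ _ Lf Lg.
apply: (eq_integrable mD _ _ _ (integrableD mD (integrableD mD f2 g2)
  (integrableZl mD 2 fg))) => x _ /=.
by rewrite -EFinM -!EFinD; congr EFin; ring.
Qed.

Lemma L2B (f g : T -> R) : L2 mu D f -> L2 mu D g -> L2 mu D (f - g).
Proof.
move=> Lf Lg; rewrite (_ : f - g = fun x => f x + -1 * g x).
  by apply: L2D => //; exact: L2Z.
by apply/funext => x; rewrite mulN1r.
Qed.

Lemma L2_cst0 : measurable D -> L2 mu D (fun=> 0).
Proof.
move=> mD; split=> //; under eq_fun do rewrite expr0n/=.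
exact: integrable0.
Qed.

Lemma L2_sum (n : nat) (F : 'I_n -> T -> R) : measurable D ->
  (forall k, L2 mu D (F k)) -> L2 mu D (fun x => \sum_k F k x).
Proof.
move=> mD LF; elim: n F LF => [|n IH] F LF.
  by under eq_fun do rewrite big_ord0; exact: L2_cst0.
under eq_fun do rewrite big_ord_recl.
by apply: L2D => //; exact: IH.
Qed.

Lemma L2_indic (A : set T) (f : T -> R) : measurable A -> L2 mu D f ->
  L2 mu D (fun x => \1_A x * f x).
Proof.
move=> mA Lf; have [_ mf _] := Lf; apply: le_L2 Lf.
  by apply: measurable_funM => //; exact: measurable_indic.
move=> x _; rewrite indicE normrM; case: (x \in A) => /=.
  by rewrite normr1 mul1r.
by rewrite normr0 mul0r.
Qed.

Hypothesis cmu : measure_is_complete mu.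

(** Completeness of [mu] is essential: [f] is arbitrary on a subset of a null set, and such a subset
    has to be measurable. *)
Lemma ae_measurable_funR (f g : T -> R) :
  {ae mu, forall x, D x -> f x = g x} -> measurable_fun D g ->
  measurable_fun D f.
Proof.
move=> fg mg; apply/measurable_EFinP.
apply: (ae_measurable_fun cmu (f := EFin \o g)); last exact/measurable_EFinP.
by apply: filterS fg => x fg Dx /=; rewrite fg.
Qed.

Lemma ae_eq_Rintegral (f g : T -> R) : measurable D -> measurable_fun D g ->
  {ae mu, forall x, D x -> f x = g x} ->
  \int[mu]_(x in D) f x = \int[mu]_(x in D) g x.
Proof.
move=> mD mg fg; rewrite /Rintegral; congr fine.
apply: (ae_eq_integral (EFin \o g) (EFin \o f)) => //.
- exact/measurable_EFinP/(ae_measurable_funR _ _ fg).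
- exact/measurable_EFinP.
- by apply: filterS fg => x fg Dx /=; rewrite fg.
Qed.

(** Almost everywhere [f] coincides with [|f|], whose integral is nonnegative. *)
Lemma ae_ge0_Rintegral (f : T -> R) : measurable D -> measurable_fun D f ->
  {ae mu, forall x, D x -> 0 <= f x} -> 0 <= \int[mu]_(x in D) f x.
Proof.
move=> mD mf f0; rewrite (@ae_eq_Rintegral _ (fun x => `|f x|))//.
- by apply: Rintegral_ge0.
- exact: measurableT_comp.
- by apply: filterS f0 => x f0 Dx; rewrite ger0_norm// f0.
Qed.

Lemma ae_L2 (f g : T -> R) : {ae mu, forall x, D x -> f x = g x} ->
  L2 mu D g -> L2 mu D f.
Proof.
move=> fg [mD mg g2]; have mf := ae_measurable_funR _ _ fg mg; split=> //.
have mf2 : measurable_fun D (fun x => (f x ^+ 2)%:E).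
  by apply/measurable_EFinP; exact: measurable_funX.
move/integrableP : g2 => [mg2 g2]; apply/integrableP; split => //.
rewrite (ae_eq_integral (fun x => `|(g x ^+ 2)%:E|%E))//.
- exact: measurableT_comp.
- exact: measurableT_comp.
- by apply: filterS fg => x fg Dx /=; rewrite fg.
Qed.

End square_integrable.

(** * Lebesgue measurability of open sets *)

(** Additivity of length when the interval [[a, b)] is cut at [c]; the truncation at 0 covers
    reversed endpoints and cuts outside the interval. *)
Lemma max_min_split (R : realDomainType) (a b c : R) :
  Num.max 0 (Num.min b c - a) + Num.max 0 (b - Num.max a c) = Num.max 0 (b - a).
Proof.
case: (leP b c) => bc; case: (leP a c) => ac.
- by rewrite [X in _ + X](max_idPl _) ?addr0//; lra.
- by rewrite [X in _ + X](max_idPl _) ?addr0//; lra.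
- by case: (leP 0 (b - a)) => ba; case: (leP 0 (c - a)) => ca;
    case: (leP 0 (b - c)) => cb; lra.
- by rewrite [X in X + _](max_idPl _) ?add0r//; lra.
Qed.

Section lebesgue_measurability.
Context {R : realType} {d : nat}.
Local Notation E := 'rV[R]_d.
Local Notation mE :=
  (caratheodory_type (lebesgue_outer : {outer_measure set E -> \bar R})).

(** Corners of the part of a box in the half-space [x 0 i < c]; [cut_above] gives the part in the
    complement. Either part may be empty, with reversed corners. *)
Let cut_below (i : 'I_d) (c : R) (ab : E * E) : E * E :=
  (ab.1, \row_j if j == i then Num.min (ab.2 0 j) c else ab.2 0 j).

Let cut_above (i : 'I_d) (c : R) (ab : E * E) : E * E :=
  (\row_j if j == i then Num.max (ab.1 0 j) c else ab.1 0 j, ab.2).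

(** Only the factor of index [i] in the product changes, and that factor splits by
    [max_min_split]. *)
Let box_volume_cut i c ab :
  (box_volume (cut_below i c ab) + box_volume (cut_above i c ab) =
   box_volume ab)%E.
Proof.
rewrite /box_volume -EFinD; congr EFin.
rewrite [X in X + _](bigD1 i)// [X in _ + X](bigD1 i)// [RHS](bigD1 i)//=.
rewrite !mxE eqxx.
under eq_bigr => j ji do rewrite !mxE (negbTE ji).
under [X in _ + _ * X]eq_bigr => j ji do rewrite !mxE (negbTE ji).
rewrite -mulrDl; congr (_ * _).
move: (ab.1 0 i) (ab.2 0 i) => a b.
exact: max_min_split.
Qed.

(** Cutting every box of a cover of [X] yields covers of the two parts of [X], and their total
    volumes add up to that of the original cover. The infimum over covers gives the Caratheodory
    inequality. *)
Lemma measurable_halfspace (i : 'I_d) (c : R) :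
  measurable ([set x : E | x 0 i < c] : set mE).
Proof.
apply: le_caratheodory_measurable => X /=.
apply: le_ereal_inf_tmp => _ [F XF <-].
(* Total volume of the cover after every box is cut by [g]; [omap] keeps the empty members
   [None]. *)
pose S g := (\sum_(k <oo) oapp (@box_volume R d) 0 (omap (g i c) (F k)))%E.
have -> : (\sum_(k <oo) oapp (@box_volume R d) 0 (F k) =
    S cut_below + S cut_above)%E.
  rewrite /S -nneseriesD; last 2 first.
  - by move=> k _ _; apply: oapp_tau_ge0; exact: box_volume_ge0.
  - by move=> k _ _; apply: oapp_tau_ge0; exact: box_volume_ge0.
  apply: eq_eseriesr => k _.
  by case: (F k) => [ab|]/=; [rewrite box_volume_cut|rewrite adde0].
apply: leeD; apply: ereal_inf_lbound.
  exists (fun k => omap (cut_below i c) (F k)) => // x [Xx xc].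
  have [k _ Fx] := XF x Xx; exists k => //.
  case: (F k) Fx => // ab /= abx j; rewrite mxE.
  have /andP[-> b] := abx j; case: eqP => [ji|//].
  by rewrite lt_min b ji.
exists (fun k => omap (cut_above i c) (F k)) => // x [Xx xc].
have [k _ Fx] := XF x Xx; exists k => //.
case: (F k) Fx => // ab /= abx j; rewrite mxE.
have /andP[a ->] := abx j; case: eqP => [ji|]; rewrite andbT//.
by rewrite ge_max a ji leNgt; apply/negP.
Qed.

Lemma measurable_box (ab : E * E) : measurable (box ab : set mE).
Proof.
rewrite (_ : box ab = \bigcap_(i in [set: 'I_d])
    ([set x | x 0 i < ab.2 0 i] `&` ~` [set x | x 0 i < ab.1 0 i])).
  apply: fin_bigcap_measurable => // i _.
  apply: measurableI; first exact: measurable_halfspace.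
  exact/measurableC/measurable_halfspace.
apply/seteqP; split=> x /=.
  move=> abx i _; have /andP[a b] := abx i.
  by split=> //=; apply/negP; rewrite -leNgt.
by move=> abx i; have [b /negP] := abx i I; rewrite -leNgt => ->.
Qed.

(** An open set is the union of the half-open boxes with rational corners that it contains, and
    there are countably many of these. *)
Lemma measurable_open (U : set E) : open U -> measurable (U : set mE).
Proof.
move=> oU.
pose ratbox (pq : 'rV[rat]_d * 'rV[rat]_d) : set E :=
  box (map_mx ratr pq.1, map_mx ratr pq.2).
rewrite (_ : U = \bigcup_pq
    (if `[< ratbox pq `<=` U >] then ratbox pq else set0)).
  apply: countable_bigcupT_measurable => [|pq]; first exact: countableP.
  by case: ifP => _ //; exact: measurable_box.
apply/seteqP; split=> [x Ux|x [pq _]]; last by case: asboolP => // + pqx; exact.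
have /nbhs_ballP[e e0 xeU] := open_nbhs_nbhs (conj oU Ux).
(* Balls are taken entrywise, so corners [p] and [q] on either side of [x], within [e] in each
   coordinate, span a box around [x] inside the ball. *)
have [p xp] : {p : 'I_d -> rat & forall i, x 0 i - e < ratr (p i) < x 0 i}.
  apply: (@choice _ _ (fun i p => x 0 i - e < ratr p < x 0 i)) => i.
  have [|p] := @rat_in_itvoo R (x 0 i - e) (x 0 i).
    by rewrite ltrBlDr ltrDl.
  by rewrite in_itv/=; exists p.
have [q xq] : {q : 'I_d -> rat & forall i, x 0 i < ratr (q i) < x 0 i + e}.
  apply: (@choice _ _ (fun i q => x 0 i < ratr q < x 0 i + e)) => i.
  have [|q] := @rat_in_itvoo R (x 0 i) (x 0 i + e).
    by rewrite ltrDl.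
  by rewrite in_itv/=; exists q.
exists (\row_i p i, \row_i q i) => //.
case: asboolP => [_|[]].
  move=> i; rewrite !mxE; have /andP[_ /ltW ->] := xp i.
  by have /andP[-> _] := xq i.
move=> y py; apply: xeU; split=> // i j; rewrite ord1 /ball/= distrC ltr_distl.
have := py j; rewrite !mxE /=; have := xp j; have := xq j.
move=> /andP[? ?] /andP[? ?] /andP[? ?]; apply/andP; split; lra.
Qed.

End lebesgue_measurability.

(** * Algebra of the inner products of functions and of fields *)

Section dot_product.
Context {R : realType} {d : nat}.
Implicit Types x y z : 'rV[R]_d.

Lemma dotC x y : dot x y = dot y x.
Proof. by apply: eq_bigr => i _; rewrite mulrC. Qed.

Lemma dotDl x y z : dot (x + y) z = dot x z + dot y z.
Proof. by rewrite -big_split; apply: eq_bigr => i _; rewrite mxE mulrDl. Qed.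

Lemma dotZl (a : R) x y : dot (a *: x) y = a * dot x y.
Proof. by rewrite mulr_sumr; apply: eq_bigr => i _; rewrite mxE mulrA. Qed.

Lemma dotNl x y : dot (- x) y = - dot x y.
Proof. by rewrite -scaleN1r dotZl mulN1r. Qed.

Lemma dot_ge0 x : 0 <= dot x x.
Proof. by apply: sumr_ge0 => i _; rewrite -expr2 sqr_ge0. Qed.

End dot_product.

Lemma lebesgue_measure_rV_complete (R : realType) (d : nat) :
  measure_is_complete (lebesgue_measure_rV R d).
Proof. exact: measure_is_complete_caratheodory. Qed.

#[local] Instance ae_vol_filter (R : realType) (d : nat) :
  Filter (almost_everywhere (lebesgue_measure_rV R d)).
Proof. exact: ae_filter_ringOfSetsType. Qed.

Section inner_product.
Context {dsp : measure_display} {T : measurableType dsp} {R : realType}.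
Context {mu : {measure set T -> \bar R}} {D : set T}.
Implicit Types f g h : T -> R.

Lemma ipC f g : ip mu D f g = ip mu D g f.
Proof. by apply: eq_Rintegral => x _; rewrite mulrC. Qed.

Lemma ipBr f g h : L2 mu D f -> L2 mu D g -> L2 mu D h ->
  ip mu D f (g - h) = ip mu D f g - ip mu D f h.
Proof.
move=> Lf Lg Lh; have [mD _ _] := Lf; rewrite /ip -RintegralB//.
- by apply: eq_Rintegral => x _; rewrite mulrBr.
- exact: L2M_integrable.
- exact: L2M_integrable.
Qed.

Lemma ipZr (a : R) f g : L2 mu D f -> L2 mu D g ->
  ip mu D f (a *: g) = a * ip mu D f g.
Proof.
move=> Lf Lg; have [mD _ _] := Lf; rewrite /ip -RintegralZl//.
  by apply: eq_Rintegral => x _; rewrite mulrCA.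
exact: L2M_integrable.
Qed.

Lemma ae_eq_ipr f g h : measure_is_complete mu ->
  L2 mu D f -> L2 mu D h ->
  {ae mu, forall x, D x -> g x = h x} -> ip mu D f g = ip mu D f h.
Proof.
move=> cmu [mD mf _] [_ mh _] gh; apply: ae_eq_Rintegral => //.
  exact: measurable_funM.
by apply: filterS gh => x gh Dx; rewrite gh.
Qed.

End inner_product.

Section vector_fields.
Context {R : realType} {d : nat} {Om : set 'rV[R]_d}.
Local Notation E := 'rV[R]_d.
Local Notation mE :=
  (caratheodory_type (lebesgue_outer : {outer_measure set E -> \bar R})).
Hypothesis mOm : measurable (Om : set mE).
Implicit Types v w : E -> E.

Let cvol := @lebesgue_measure_rV_complete R d.

Lemma L2fieldD v w : L2field Om v -> L2field Om w -> L2field Om (v + w).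
Proof.
move=> Lv Lw i.
rewrite (_ : (fun x => _) = fun x => v x 0 i + w x 0 i); first exact: L2D.
by apply/funext => x; rewrite [LHS]mxE.
Qed.

Lemma L2fieldZ (a : R) v : L2field Om v -> L2field Om (a *: v).
Proof.
move=> Lv i.
rewrite (_ : (fun x => _) = fun x => a * v x 0 i); first exact: L2Z.
by apply/funext => x; rewrite [LHS]mxE.
Qed.

Lemma L2fieldB v w : L2field Om v -> L2field Om w -> L2field Om (v - w).
Proof.
by move=> Lv Lw; rewrite -scaleN1r; exact: (L2fieldD _ _ Lv (L2fieldZ _ _ Lw)).
Qed.

Lemma dot_integrable v w : L2field Om v -> L2field Om w ->
  (lebesgue_measure_rV R d).-integrable Om (EFin \o (fun x => dot (v x) (w x))).
Proof.
move=> Lv Lw; under [EFin \o _]eq_fun do rewrite /= -sumEFin.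
apply: integrable_sum => // i _; exact: (L2M_integrable _ _ (Lv i) (Lw i)).
Qed.

Lemma ipfieldC v w : ipfield Om v w = ipfield Om w v.
Proof. by apply: eq_Rintegral => x _; rewrite dotC. Qed.

Lemma ipfieldDl v w z : L2field Om v -> L2field Om w -> L2field Om z ->
  ipfield Om (v + w) z = ipfield Om v z + ipfield Om w z.
Proof.
move=> Lv Lw Lz; rewrite /ipfield -RintegralD//.
- by apply: eq_Rintegral => x _; rewrite -dotDl.
- exact: dot_integrable.
- exact: dot_integrable.
Qed.

Lemma ipfieldZl (a : R) v w : L2field Om v -> L2field Om w ->
  ipfield Om (a *: v) w = a * ipfield Om v w.
Proof.
move=> Lv Lw; rewrite /ipfield -RintegralZl//.
  by apply: eq_Rintegral => x _; rewrite -dotZl.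
exact: dot_integrable.
Qed.

Lemma ipfieldDr v w z : L2field Om v -> L2field Om w -> L2field Om z ->
  ipfield Om z (v + w) = ipfield Om z v + ipfield Om z w.
Proof. by move=> *; rewrite ipfieldC ipfieldDl// !(ipfieldC z). Qed.

Lemma ipfieldZr (a : R) v w : L2field Om v -> L2field Om w ->
  ipfield Om w (a *: v) = a * ipfield Om w v.
Proof. by move=> *; rewrite ipfieldC ipfieldZl// (ipfieldC w). Qed.

Lemma ipfieldBr v w z : L2field Om v -> L2field Om w -> L2field Om z ->
  ipfield Om z (v - w) = ipfield Om z v - ipfield Om z w.
Proof.
move=> Lv Lw Lz; rewrite -scaleN1r (ipfieldDr _ _ _ Lv (L2fieldZ _ _ Lw) Lz).
by rewrite (ipfieldZr _ _ _ Lw Lz) mulN1r.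
Qed.

(** Comparing the integrands rather than the fields allows a scalar weight to move from one factor
    to the other. *)
Lemma ae_eq_ipfield v w v' w' : L2field Om v' -> L2field Om w' ->
  {ae vol, forall x, Om x -> dot (v x) (w x) = dot (v' x) (w' x)} ->
  ipfield Om v w = ipfield Om v' w'.
Proof.
move=> Lv' Lw' vw; apply: (ae_eq_Rintegral cvol _ _ mOm _ vw).
by have /integrableP[/measurable_EFinP] := dot_integrable _ _ Lv' Lw'.
Qed.

End vector_fields.

(** * The piecewise constant coefficient and the energy norm *)

Section coefficient.
Context {R : realType} {d : nat} {Om : set 'rV[R]_d} {nu : 'rV[R]_d -> R}.
Local Notation E := 'rV[R]_d.
Local Notation mE :=
  (caratheodory_type (lebesgue_outer : {outer_measure set E -> \bar R})).
Hypothesis mOm : measurable (Om : set mE).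
Hypothesis hnu : piecewise_constant_coefficient Om nu.
Implicit Types v w : E -> E.

Let cvol := @lebesgue_measure_rV_complete R d.

(** The exceptional set lies in the null complement of the pieces, which is measurable because the
    pieces are open. *)
Lemma ae_piecewise (n : nat) (A : 'I_n -> set E) (P : E -> Prop) :
  (forall k, open (A k)) ->
  vol (Om `\` \bigcup_(k in [set: 'I_n]) A k) = 0%E ->
  (forall k x, A k x -> P x) -> {ae vol, forall x, Om x -> P x}.
Proof.
move=> oA A0 AP; exists (Om `\` \bigcup_(k in [set: 'I_n]) A k); split => //.
  apply: measurableD => //; apply: fin_bigcup_measurable => // k _.
  exact/measurable_open/oA.
move=> x /= /not_implyP[Omx nPx]; split=> // -[k _ Akx].
exact/nPx/(AP k).
Qed.

(** Off a null set, [a * g] is the sum of the functions [c k * (\1_(A k) * g)], of which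
    disjointness leaves a single nonzero term at each point. The lemma serves both [nu] and its
    inverse. *)
Lemma L2_piecewise (n : nat) (A : 'I_n -> set E) (c : 'I_n -> R) (a : E -> R)
    (g : E -> R) :
  (forall k, open (A k)) -> trivIset setT A ->
  vol (Om `\` \bigcup_(k in [set: 'I_n]) A k) = 0%E ->
  (forall k x, A k x -> a x = c k) ->
  L2 vol Om g -> L2 vol Om (fun x => a x * g x).
Proof.
move=> oA tA A0 ac Lg.
apply: (ae_L2 cvol _ (fun x => \sum_k c k * (\1_(A k) x * g x))); last first.
  apply: (L2_sum _ _ mOm) => k; apply: L2Z.
  by apply: (L2_indic _ _ _ Lg); exact/measurable_open/oA.
apply: (ae_piecewise _ _ _ oA A0) => k x Akx.
rewrite (bigD1 k)//= big1 ?addr0 => [|j jk].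
  by rewrite (ac k)// indicE mem_set// mul1r.
rewrite indicE memNset ?mul0r ?mulr0// => Ajx.
by move/eqP : jk; apply; apply: tA => //; exists x.
Qed.

Lemma coefficient_gt0 : {ae vol, forall x, Om x -> 0 < nu x}.
Proof.
have [n [A [c [oA _ A0 c0 nuc]]]] := hnu.
apply: (ae_piecewise _ _ _ _ A0) => [k|k x Akx]; first by have [] := oA k.
by rewrite (nuc k).
Qed.

Lemma L2field_weighted v : L2field Om v -> L2field Om (weighted nu v).
Proof.
have [n [A [c [oA tA A0 _ nuc]]]] := hnu => Lv i.
under eq_fun do rewrite mxE.
apply: (L2_piecewise _ _ _ _ _ _ tA A0 nuc) => // k; by have [] := oA k.
Qed.

Lemma L2field_weightedV v : L2field Om v ->
  L2field Om (weighted (fun x => (nu x)^-1) v).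
Proof.
have [n [A [c [oA tA A0 _ nuc]]]] := hnu => Lv i.
under eq_fun do rewrite mxE.
apply: (L2_piecewise _ _ (fun k => (c k)^-1) _ _ _ tA A0) => // k.
  by have [] := oA k.
by move=> x Akx; rewrite (nuc k).
Qed.

(** [Num.sqrt] is 0 on negative numbers; positivity of [nu] almost everywhere makes the integral
    nonnegative, so that squaring recovers it. *)
Lemma energy_norm_sqr v : L2field Om v ->
  energy_norm Om nu v ^+ 2 =
  ipfield Om (weighted (fun x => (nu x)^-1) v) v.
Proof.
move=> Lv; rewrite sqr_sqrtr//; apply: (ae_ge0_Rintegral cvol _ mOm).
  by have /integrableP[/measurable_EFinP] :=
    dot_integrable mOm _ _ (L2field_weightedV _ Lv) Lv.
apply: filterS coefficient_gt0 => x nu0 Omx.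
by rewrite dotZl mulr_ge0 ?dot_ge0// invr_ge0 ltW// nu0.
Qed.

(** * Consequences of the constitutive law; [g] stands for the gradient and [q] for its flux *)

Section flux.
Context {g q : E -> E}.
Hypothesis (Lg : L2field Om g) (Lq : L2field Om q).
Hypothesis qg : {ae vol, forall x, Om x -> q x = - weighted nu g x}.

Lemma ipfield_weighted v : L2field Om v ->
  ipfield Om g (weighted nu v) = - ipfield Om q v.
Proof.
move=> Lv; rewrite -[RHS]mulN1r -ipfieldZl//.
apply: (ae_eq_ipfield mOm _ _ _ _ (L2fieldZ _ _ Lq) Lv).
apply: filterS qg => x qgx Omx.
rewrite -[RHS]/(dot (-1 *: q x) (v x)) qgx// /weighted dotZl dotNl dotZl.
by rewrite (dotC (g x)) dotZl (dotC (v x)); ring.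
Qed.

(** Expansion of [|||2 k q + w|||^2], in which [nu^-1 q = - g] removes the weight from every term
    except [|||w|||^2]. *)
Lemma energy_norm_flux (k : R) v w : L2field Om v -> L2field Om w ->
  {ae vol, forall x, Om x -> v x = (- (2 * k)) *: q x - w x} ->
  energy_norm Om nu v ^+ 2 = energy_norm Om nu w ^+ 2
    - 4 * k ^+ 2 * ipfield Om g q - 4 * k * ipfield Om g w.
Proof.
move=> Lv Lw vqw; rewrite !energy_norm_sqr//.
have LVw := L2field_weightedV _ Lw.
set Vw := weighted _ w in LVw *.
(* The weight moves from [w] to [q], where it produces [- g]. *)
have Vwq : ipfield Om Vw q = - ipfield Om g w.
  rewrite -[RHS]mulN1r -ipfieldZl//.
  apply: (ae_eq_ipfield mOm _ _ _ _ (L2fieldZ _ _ Lg) Lw).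
  apply: filterS2 qg coefficient_gt0 => x qgx nu0 Omx.
  rewrite -[RHS]/(dot (-1 *: g x) (w x)) /Vw /weighted qgx// !dotZl.
  rewrite dotC dotNl dotZl mulrN mulKf ?mulN1r//.
  by rewrite gt_eqF// nu0.
have Zg := L2fieldZ (2 * k) _ Lg.
have ZVw := L2fieldZ (-1) _ LVw.
have Zq := L2fieldZ (- (2 * k)) _ Lq.
have Zw := L2fieldZ (-1) _ Lw.
have Lqw := L2fieldD _ _ Zq Zw.
(* Almost everywhere [nu^-1 v = 2 k g - nu^-1 w], which replaces the first factor. *)
rewrite (ae_eq_ipfield mOm _ _ _ _ (L2fieldD _ _ Zg ZVw) Lqw).
  rewrite (ipfieldDl mOm _ _ _ Zg ZVw Lqw).
  rewrite (ipfieldZl mOm _ _ _ Lg Lqw) (ipfieldZl mOm _ _ _ LVw Lqw).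
  rewrite (ipfieldDr mOm _ _ _ Zq Zw Lg) (ipfieldDr mOm _ _ _ Zq Zw LVw).
  rewrite !(ipfieldZr mOm _ _ _ Lq) ?(ipfieldZr mOm _ _ _ Lw); [|assumption..].
  by rewrite Vwq; ring.
apply: filterS3 qg coefficient_gt0 vqw => x qgx nu0 vqwx Omx.
rewrite -[RHS]/(dot (2 * k *: g x + -1 *: ((nu x)^-1 *: w x))
  (- (2 * k) *: q x + -1 *: w x)) /weighted vqwx// !scaleN1r.
congr (dot _ _); rewrite scalerBr qgx// scalerN scaleNr opprK !scalerA.
by congr (_ *: _ - _); field; rewrite gt_eqF// nu0.
Qed.

End flux.
End coefficient.

(** * Linear functionals and membership in the trace spaces *)

Lemma linear_onN (R : realType) (V : lmodType R) (A : set V) (f : V -> R)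
    (x : V) :
  linear_on A f -> A x -> f (- x) = - f x.
Proof.
move=> lf Ax; have := lf 1 (fun=> -1) (fun=> x) (fun=> Ax).
by rewrite !big_ord1 scaleN1r mulN1r.
Qed.

(** The set [A] is not assumed closed under differences, so linearity is applied once, to a
    combination of four elements of [A]. *)
Lemma linear_onB4 (R : realType) (V : lmodType R) (A : set V) (f : V -> R)
    (a b : R) (x y z t : V) :
  linear_on A f -> A x -> A y -> A z -> A t ->
  f (a *: (x - y) - b *: (z - t)) = a * (f x - f y) - b * (f z - f t).
Proof.
move=> lf Ax Ay Az At.
pose c := tnth [tuple a; - a; - b; b]; pose v := tnth [tuple x; y; z; t].
rewrite (_ : _ - _ = \sum_k c k *: v k).
  rewrite lf => [|[[|[|[|[|//]]]] k]]; rewrite /v /c ?(tnth_nth x)//.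
  by rewrite /v /c !big_ord_recl big_ord0 !(tnth_nth x) !(tnth_nth a) /=; ring.
rewrite /v /c !big_ord_recl big_ord0 !(tnth_nth x) !(tnth_nth a) /=.
by rewrite addr0 !scaleNr !scalerBr opprD opprK !addrA.
Qed.

#[local] Instance ae_surf_filter (R : realType) (d : nat) :
  Filter (almost_everywhere (surface_measure R d)).
Proof. exact: ae_filter_ringOfSetsType. Qed.

Section traces.
Context {R : realType} {d : nat} {Om : set 'rV[R]_d}.

Lemma trace_space_trace (G : set 'rV[R]_d) (w : sobolev R d) :
  H1 Om w -> trace_space Om G (trace Om w).
Proof. by move=> hw; exists w => //; exact: aeW. Qed.

(** Makes the Dirichlet data admissible in the pairing on [GD], with the exact solutions [u] and
    [xi] as liftings. *)
Lemma trace_space_ae (G : set 'rV[R]_d) (w : sobolev R d) (g : 'rV[R]_d -> R) :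
  H1 Om w -> {ae surf, forall x, G x -> trace Om w x = g x} ->
  trace_space Om G g.
Proof. by move=> hw wg; exists w => //; apply: filterS wg => x wg /wg. Qed.

End traces.

(** * The representation of the quantity of interest *)

Theorem theorem3 (R : realType) (d : nat) (hd : d = 2%N \/ d = 3%N)
  (Om GD GN : set 'rV[R]_d)
  (hOm : polyhedral_domain Om) (hG : boundary_partition Om GD GN)
  (nu : 'rV[R]_d -> R) (hnu : piecewise_constant_coefficient Om nu)
  (f fO gD gDO gN gNO : 'rV[R]_d -> R)
  (hf : L2 vol Om f) (hfO : L2 vol Om fO)
  (hgN : L2 surf GN gN) (hgNO : L2 surf GN gNO)
  (hgD : {within GD, continuous gD}) (hgDO : {within GD, continuous gDO})
  (bD bN : hdiv R d -> ('rV[R]_d -> R) -> R)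
  (hbD : normal_pairing Om GD bD) (hbN : normal_pairing Om GN bN)
  (hgreen : green_formula Om bD bN)
  (u xi : sobolev R d) (q zeta : hdiv R d)
  (hprimal : mixed_solution Om GD GN bN nu f gD gN u q)
  (hadjoint : mixed_solution Om GD GN bN nu fO gDO (- gNO) xi zeta)
  (ut xit : sobolev R d) (qt zetat : hdiv R d)
  (hut : H1 Om ut) (hxit : H1 Om xit)
  (hqt : Hdiv Om qt) (hzetat : Hdiv Om zetat)
  (kappa : R) (hkappa : 0 < kappa)
  (sg : R) (hsg : sg = 1 \/ sg = -1) :
  let s := ellO Om GN bD fO gDO gNO u q in
  sg * s =
    sg * s_hat Om GN bD nu sg kappa f gD gN ut xit qt zetat
    + (4 * kappa)^-1 *
      energy_norm Om nu
        ((e_varphi sg kappa q qt zeta zetat).1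
         - weighted nu (grad (e_phi sg kappa u ut xi xit))) ^+ 2
    + ip vol Om u.1 (sg *: (fO - div zetat) - kappa *: (f - div qt))
    - ((- sg) *: (L2_functional GN gNO + bN zetat)
       - kappa *: (L2_functional GN gN - bN qt)) (trace Om u)
    - bD q ((- sg) *: (gDO - trace Om xit) - kappa *: (gD - trace Om ut)).
Proof.
move=> s.
have [[hu hq] qu divq uD bNq] := hprimal.
have [[hxi hzeta] zetaxi _ xiD _] := hadjoint.
have [Lu Lgu _] := hu; have [Lut Lgut _] := hut.
have [_ Lgxi _] := hxi; have [Lxit Lgxit _] := hxit.
have [Lq Ldq _] := hq; have [Lqt Ldqt _] := hqt.
have [Lz Ldz _] := hzeta; have [Lzt Ldzt _] := hzetat.
have [mOm _ _] := Lu.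
have cvol := @lebesgue_measure_rV_complete R d.
have tu G := trace_space_trace G u hu.
have txit G := trace_space_trace G xit hxit.
have tut G := trace_space_trace G ut hut.
have tgD := trace_space_ae _ _ _ hu uD.
have tgDO := trace_space_ae _ _ _ hxi xiD.
have bDu v : Hdiv Om v -> bD v (trace Om u) = bD v gD.
  by move=> hv; exact: (normal_pairing_ae hbD hv (tu GD) tgD uD).
have bNq_ip w : H1 Om w -> bN q (trace Om w) = ip surf GN gN (trace Om w).
  by move=> hw; apply: bNq; apply/mem_set; exact: trace_space_trace.
have divq_ip (w : 'rV[R]_d -> R) : L2 vol Om w ->
  ip vol Om (div q) w = ip vol Om f w.
  move=> Lw; rewrite ipC [RHS]ipC.
  exact: (ae_eq_ipr _ _ _ cvol Lw hf divq).
pose Y := sg *: (zetat.1 + weighted nu (grad xit))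
  - kappa *: (qt.1 - weighted nu (grad ut)).
have Lnxit := L2field_weighted mOm hnu _ Lgxit.
have Lnut := L2field_weighted mOm hnu _ Lgut.
have LY1 := L2fieldD _ _ Lzt Lnxit.
have LY2 := L2fieldB _ _ Lqt Lnut.
have LY : L2field Om Y :=
  L2fieldB _ _ (L2fieldZ sg _ LY1) (L2fieldZ kappa _ LY2).
(* By symmetry of the weight, [nu grad xit] and [nu grad ut] tested with [grad u] become
   [- grad xit] and [- grad ut] tested with [q]; only unweighted pairings of a flux with a gradient
   remain. *)
have ipY : ipfield Om (grad u) Y =
    sg * (ipfield Om zetat.1 (grad u) - ipfield Om q.1 (grad xit))
    - kappa * (ipfield Om qt.1 (grad u) + ipfield Om q.1 (grad ut)).
  rewrite (ipfieldBr mOm _ _ _ (L2fieldZ sg _ LY1) (L2fieldZ kappa _ LY2) Lgu).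
  rewrite (ipfieldZr mOm _ _ _ LY1 Lgu) (ipfieldZr mOm _ _ _ LY2 Lgu).
  rewrite (ipfieldDr mOm _ _ _ Lzt Lnxit Lgu).
  rewrite (ipfieldBr mOm _ _ _ Lqt Lnut Lgu).
  rewrite (ipfield_weighted mOm Lq qu _ Lgxit).
  rewrite (ipfield_weighted mOm Lq qu _ Lgut) opprK.
  by rewrite (ipfieldC _ zetat.1) (ipfieldC _ qt.1).
set X := (e_varphi _ _ _ _ _ _).1 - _.
have LX : L2field Om X.
  apply: L2fieldB; first exact (L2fieldB _ _
    (L2fieldZ sg _ (L2fieldB _ _ Lz Lzt))
    (L2fieldZ kappa _ (L2fieldB _ _ Lq Lqt))).
  apply: (L2field_weighted mOm hnu).
  exact (L2fieldB _ _ (L2fieldZ (- sg) _ (L2fieldB _ _ Lgxi Lgxit))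
    (L2fieldZ kappa _ (L2fieldB _ _ Lgu Lgut))).
(* The exact adjoint part [zeta + nu grad xi] vanishes, and the exact primal part [q - nu grad u]
   equals [2 q]. *)
have XY : {ae vol, forall x, Om x -> X x = (- (2 * kappa)) *: q.1 x - Y x}.
  apply: filterS2 qu zetaxi => x qux zetaxix Omx.
  rewrite -[LHS]/(sg *: (zeta.1 x - zetat.1 x) - kappa *: (q.1 x - qt.1 x)
    - nu x *: ((- sg) *: (grad xi x - grad xit x)
               - kappa *: (grad u x - grad ut x))).
  rewrite -[Y x]/(sg *: (zetat.1 x + nu x *: grad xit x)
    - kappa *: (qt.1 x - nu x *: grad ut x)).
  rewrite qux// zetaxix// /weighted; apply/rowP => i; rewrite !mxE; ring.
have XX := energy_norm_flux mOm hnu Lgu Lq qu kappa X Y LX LY XY.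
have ipu : ip vol Om u.1 (sg *: (fO - div zetat) - kappa *: (f - div qt)) =
    sg * (ip vol Om fO u.1 - ip vol Om (div zetat) u.1)
    - kappa * (ip vol Om f u.1 - ip vol Om (div qt) u.1).
  have LA := L2B _ _ hfO Ldzt; have LB := L2B _ _ hf Ldqt.
  rewrite (ipBr _ _ _ Lu (L2Z sg _ LA) (L2Z kappa _ LB)).
  rewrite (ipZr _ _ _ Lu LA) (ipZr _ _ _ Lu LB).
  rewrite (ipBr _ _ _ Lu hfO Ldzt) (ipBr _ _ _ Lu hf Ldqt).
  by congr (_ * (_ - _) - _ * (_ - _)); exact: ipC.
rewrite (linear_onB4 _ _ _ _ _ _ _ _ _ _ (normal_pairing_linearr hbD hq)
  tgDO (txit _) tgD (tut _)).
rewrite -[X in _ - X - _]/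
  ((- sg) * (ip surf GN gNO (trace Om u) + bN zetat (trace Om u))
  - kappa * (ip surf GN gN (trace Om u) - bN qt (trace Om u))).
rewrite ipu XX ipY (ipfieldC (grad u)) /s /ellO /s_hat /ell.
rewrite (linear_onN _ _ _ (bD^~ gD) _ (normal_pairing_linearl hbD tgD) hzetat).
rewrite -/Y.
(* One Green formula for each of the five flux-gradient pairings left by [XX] and [ipY]. *)
have Gqu := hgreen _ _ hq hu; have Gzu := hgreen _ _ hzetat hu.
have Gqx := hgreen _ _ hq hxit; have Gqtu := hgreen _ _ hqt hu.
have Gqut := hgreen _ _ hq hut.
(* The primal problem supplies the data: [gD] for the trace of [u], [gN] for the normal trace of
   [q], [f] for its divergence. *)
rewrite (bDu _ hq) (bNq_ip _ hu) (divq_ip u.1 Lu) in Gqu.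
rewrite (bDu _ hzetat) in Gzu.
rewrite (bNq_ip _ hxit) (divq_ip xit.1 Lxit) in Gqx.
rewrite (bDu _ hqt) in Gqtu.
rewrite (bNq_ip _ hut) (divq_ip ut.1 Lut) in Gqut.
rewrite (canRL (addrK _) Gqu) (canRL (addrK _) Gzu) (canRL (addrK _) Gqx).
rewrite (canRL (addrK _) Gqtu) (canRL (addrK _) Gqut).
have k0 : kappa != 0 by rewrite gt_eqF.
cbv beta.
(* Without abstracting the atoms, [field] compares measures up to conversion
   and does not terminate in reasonable time. *)
generalize (energy_norm Om nu Y) => e.
repeat match goal with
  | |- context [ip ?m ?D ?f ?g] => generalize (ip m D f g); intro
  | |- context [bD ?v ?g] => generalize (bD v g); intro
  | |- context [bN ?v ?g] => generalize (bN v g); intro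
  end.
(* The identity relies on [sg ^+ 2 = 1], because [s_hat] already carries a factor [sg]; hence the
   two cases. *)
by case: hsg => ->; field.
Qed.
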